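(* The following two rules are derivable in $\mathbf{GMALL}$, for every formula $A$ and all finite multisets of formulae $\Gamma,\Delta$: $(K\boxdot)$ from $\Gamma\Rightarrow A$ infer $\boxdot\Gamma\Rightarrow\boxdot A$; $(K\Diamond)$ from $A\Rightarrow\Delta$ infer $\Diamond A\Rightarrow\Diamond\Delta$.
   Context: Formulae are built from propositional variables and constants $0,1,\bot,\top$ using the connectives $\otimes$, $\oplus$ (multiplicative disjunction, ''par''), $\land$, $\lor$ (additive conjunction and disjunction), $\neg$, $\to$. A sequent $\Gamma\Rightarrow\Delta$ is a pair of finite multisets of formulae; commas denote multiset union. A rule is derivable in a calculus if its conclusion can be derived from its premisses using the rules of the calculus. The calculus $\mathbf{GMALL}$ for Multiplicative Additive Linear Logic has the following rules (no cut, weakening or contraction). Axioms: $A\Rightarrow A$; $0\Rightarrow{}$; ${}\Rightarrow 1$; $\bot,\Gamma\Rightarrow\Delta$; $\Gamma\Rightarrow\Delta,\top$. $(R0)$ from $\Gamma\Rightarrow\Delta$ infer $\Gamma\Rightarrow\Delta,0$. $(L1)$ from $\Gamma\Rightarrow\Delta$ infer $1,\Gamma\Rightarrow\Delta$. $(L\otimes)$ from $\Gamma,A,B\Rightarrow\Delta$ infer $A\otimes B,\Gamma\Rightarrow\Delta$. $(R\otimes)$ from $\Gamma\Rightarrow\Delta,A$ and $\Gamma'\Rightarrow\Delta',B$ infer $\Gamma,\Gamma'\Rightarrow\Delta,\Delta',A\otimes B$. $(L\oplus)$ from $A,\Gamma\Rightarrow\Delta$ and $B,\Gamma'\Rightarrow\Delta'$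 infer $A\oplus B,\Gamma,\Gamma'\Rightarrow\Delta,\Delta'$. $(R\oplus)$ from $\Gamma\Rightarrow\Delta,A,B$ infer $\Gamma\Rightarrow\Delta,A\oplus B$. $(L\land_1),(L\land_2)$ from $A,\Gamma\Rightarrow\Delta$, respectively from $B,\Gamma\Rightarrow\Delta$, infer $A\land B,\Gamma\Rightarrow\Delta$. $(R\land)$ from $\Gamma\Rightarrow\Delta,A$ and $\Gamma\Rightarrow\Delta,B$ infer $\Gamma\Rightarrow\Delta,A\land B$. $(L\lor)$ from $A,\Gamma\Rightarrow\Delta$ and $B,\Gamma\Rightarrow\Delta$ infer $A\lor B,\Gamma\Rightarrow\Delta$. $(R\lor_1),(R\lor_2)$ from $\Gamma\Rightarrow\Delta,A$, respectively from $\Gamma\Rightarrow\Delta,B$, infer $\Gamma\Rightarrow\Delta,A\lor B$. $(L\neg)$ from $\Gamma\Rightarrow\Delta,A$ infer $\neg A,\Gamma\Rightarrow\Delta$. $(R\neg)$ from $A,\Gamma\Rightarrow\Delta$ infer $\Gamma\Rightarrow\Delta,\neg A$. $(L\to)$ from $\Gamma\Rightarrow\Delta,A$ and $B,\Gamma'\Rightarrow\Delta'$ infer $A\to B,\Gamma,\Gamma'\Rightarrow\Delta,\Delta'$. $(R\to)$ from $A,\Gamma\Rightarrow\Delta,B$ infer $\Gamma\Rightarrow\Delta,A\to B$. The Tarskian modalities are the abbreviations $\Diamond A := \neg A\to A$ and $\boxdot A := \neg\Diamond\neg A$. For a multiset $\Gamma$, $\boxdot\Gamma$ (resp. $\Diamond\Gamma$)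 denotes the multiset obtained by prefixing each member of $\Gamma$ with $\boxdot$ (resp. $\Diamond$). *)

(* Defs.v *)
From HB Require Import structures.
From mathcomp Require Import all_boot.
From mathcomp Require Import finmap multiset.

Set Implicit Arguments.
Unset Strict Implicit.
Unset Printing Implicit Defensive.

Local Open Scope mset_scope.

(* [Zero] and [One] are the multiplicative constants, [Bot] and [Top] the
   additive ones; this is not Girard's naming. *)
Inductive formula : Type :=
| Var of nat
| Zero
| One
| Bot
| Top
| Tensor of formula & formula
| Par of formula & formula
| And of formula & formula
| Or of formula & formula
| Neg of formula
| Imp of formula & formula.

(* Encoding into generic trees, used only to obtain the [choiceType] structure
   that [{mset formula}] requires. *)
Fixpoint tree_of_formula (A : formula) : GenTree.tree nat :=
  match A with
  | Var n => GenTree.Leaf n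
  | Zero => GenTree.Node 0 [::]
  | One => GenTree.Node 1 [::]
  | Bot => GenTree.Node 2 [::]
  | Top => GenTree.Node 3 [::]
  | Tensor A B => GenTree.Node 4 [:: tree_of_formula A; tree_of_formula B]
  | Par A B => GenTree.Node 5 [:: tree_of_formula A; tree_of_formula B]
  | And A B => GenTree.Node 6 [:: tree_of_formula A; tree_of_formula B]
  | Or A B => GenTree.Node 7 [:: tree_of_formula A; tree_of_formula B]
  | Neg A => GenTree.Node 8 [:: tree_of_formula A]
  | Imp A B => GenTree.Node 9 [:: tree_of_formula A; tree_of_formula B]
  end.

Fixpoint formula_of_tree (t : GenTree.tree nat) : option formula :=
  let bin c s t :=
    obind (fun A => omap (c A) (formula_of_tree t)) (formula_of_tree s) in
  match t with
  | GenTree.Leaf n => Some (Var n)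
  | GenTree.Node 0 [::] => Some Zero
  | GenTree.Node 1 [::] => Some One
  | GenTree.Node 2 [::] => Some Bot
  | GenTree.Node 3 [::] => Some Top
  | GenTree.Node 4 [:: s; t] => bin Tensor s t
  | GenTree.Node 5 [:: s; t] => bin Par s t
  | GenTree.Node 6 [:: s; t] => bin And s t
  | GenTree.Node 7 [:: s; t] => bin Or s t
  | GenTree.Node 8 [:: s] => omap Neg (formula_of_tree s)
  | GenTree.Node 9 [:: s; t] => bin Imp s t
  | _ => None
  end.

Lemma tree_of_formulaK : pcancel tree_of_formula formula_of_tree.
Proof. by elim=> //= [A -> B ->|A -> B ->|A -> B ->|A -> B ->|A ->|A -> B ->]. Qed.

HB.instance Definition _ := Countable.copy formula (pcan_type tree_of_formulaK).

Definition Dia (A : formula) : formula := Imp (Neg A) A.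
Definition Boxdot (A : formula) : formula := Neg (Dia (Neg A)).

(* Image of a multiset, counting multiplicities. *)
Definition mset_map (f : formula -> formula) (G : {mset formula}) :
    {mset formula} :=
  seq_mset [seq f A | A <- enum_mset G].

Definition sequent : Type := ({mset formula} * {mset formula})%type.

Notation "G ⇒ D" := ((G, D) : sequent) (at level 70, no associativity).

(* [derivable P S]: the sequent [S] has a derivation in GMALL whose leaves are
   axioms or members of [P]; a member of [P] may be used any number of times. *)
Inductive derivable (P : seq sequent) : sequent -> Prop :=
| Premiss S : S \in P -> derivable P S
| Ax A : derivable P ([mset A] ⇒ [mset A])
| L0 : derivable P ([mset Zero] ⇒ mset0)
| R1 : derivable P (mset0 ⇒ [mset One])
| LBot G D : derivable P (Bot +` G ⇒ D)
| RTop G D : derivable P (G ⇒ D `+` [mset Top])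
| R0 G D : derivable P (G ⇒ D) -> derivable P (G ⇒ D `+` [mset Zero])
| L1 G D : derivable P (G ⇒ D) -> derivable P (One +` G ⇒ D)
| LTensor G D A B :
    derivable P (G `+` [mset A] `+` [mset B] ⇒ D) ->
    derivable P (Tensor A B +` G ⇒ D)
| RTensor G D G' D' A B :
    derivable P (G ⇒ D `+` [mset A]) ->
    derivable P (G' ⇒ D' `+` [mset B]) ->
    derivable P (G `+` G' ⇒ D `+` D' `+` [mset Tensor A B])
| LPar G D G' D' A B :
    derivable P (A +` G ⇒ D) ->
    derivable P (B +` G' ⇒ D') ->
    derivable P (Par A B +` G `+` G' ⇒ D `+` D')
| RPar G D A B :
    derivable P (G ⇒ D `+` [mset A] `+` [mset B]) ->
    derivable P (G ⇒ D `+` [mset Par A B])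
| LAnd1 G D A B :
    derivable P (A +` G ⇒ D) -> derivable P (And A B +` G ⇒ D)
| LAnd2 G D A B :
    derivable P (B +` G ⇒ D) -> derivable P (And A B +` G ⇒ D)
| RAnd G D A B :
    derivable P (G ⇒ D `+` [mset A]) ->
    derivable P (G ⇒ D `+` [mset B]) ->
    derivable P (G ⇒ D `+` [mset And A B])
| LOr G D A B :
    derivable P (A +` G ⇒ D) ->
    derivable P (B +` G ⇒ D) ->
    derivable P (Or A B +` G ⇒ D)
| ROr1 G D A B :
    derivable P (G ⇒ D `+` [mset A]) -> derivable P (G ⇒ D `+` [mset Or A B])
| ROr2 G D A B :
    derivable P (G ⇒ D `+` [mset B]) -> derivable P (G ⇒ D `+` [mset Or A B])
| LNeg G D A :
    derivable P (G ⇒ D `+` [mset A]) -> derivable P (Neg A +` G ⇒ D)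
| RNeg G D A :
    derivable P (A +` G ⇒ D) -> derivable P (G ⇒ D `+` [mset Neg A])
| LImp G D G' D' A B :
    derivable P (G ⇒ D `+` [mset A]) ->
    derivable P (B +` G' ⇒ D') ->
    derivable P (Imp A B +` G `+` G' ⇒ D `+` D')
| RImp G D A B :
    derivable P (A +` G ⇒ D `+` [mset B]) ->
    derivable P (G ⇒ D `+` [mset Imp A B]).

(* Main.v *)
Require Import Defs.
From mathcomp Require Import all_boot.
From mathcomp Require Import finmap multiset.

Local Open Scope mset_scope.

(** The Tarskian modalities are disguised multiplicatives: [Dia A], that is
    [Neg A -> A], behaves as the par of [A] with itself, and [Boxdot A] as the
    tensor of [A] with itself.  So [Dia A] on the left combines two derivations
    that use [A] ([dia_left]), while [Dia A] on the right may replace two copies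
    of [A] in a single derivation ([dia_right]); dually for [Boxdot]
    ([boxdot_right], [boxdot_left]).

    Both rules then follow by using the premiss twice.  For [Dia], two copies of
    [A ⇒ D] give [Dia A ⇒ D, D], and the duplicated members of [D] are merged
    pairwise, one formula after another, into [Dia D].  For [Boxdot], two
    copies of [G ⇒ A] give [G, G ⇒ Boxdot A], and [G, G] is merged into
    [Boxdot G]. *)

Lemma dia_left (P : seq sequent) (A : formula) (G D G' D' : {mset formula}) :
  derivable P (A +` G ⇒ D) -> derivable P (A +` G' ⇒ D') ->
  derivable P (Dia A +` G `+` G' ⇒ D `+` D').
Proof. by move=> dA; apply: LImp; apply: RNeg. Qed.

Lemma dia_right (P : seq sequent) (A : formula) (G D : {mset formula}) :
  derivable P (G ⇒ D `+` [mset A] `+` [mset A]) ->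
  derivable P (G ⇒ D `+` [mset Dia A]).
Proof. by move=> dAA; apply: RImp; apply: LNeg. Qed.

Lemma boxdot_right (P : seq sequent) (A : formula) (G D G' D' : {mset formula}) :
  derivable P (G ⇒ D `+` [mset A]) -> derivable P (G' ⇒ D' `+` [mset A]) ->
  derivable P (G `+` G' ⇒ D `+` D' `+` [mset Boxdot A]).
Proof.
move=> dA dA'; apply: RNeg; rewrite msetDA.
by apply: dia_left; apply: LNeg.
Qed.

Lemma boxdot_left (P : seq sequent) (A : formula) (G D : {mset formula}) :
  derivable P (A +` (A +` G) ⇒ D) -> derivable P (Boxdot A +` G ⇒ D).
Proof. by move=> dAA; apply/LNeg/dia_right; do 2!apply: RNeg. Qed.

Lemma seq_mset_nil : seq_mset [::] = mset0 :> {mset formula}.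
Proof. by rewrite -enum_mset0 seq_mset_id. Qed.

(** One pair is merged at a time; the context [E] is there so that, in the
    induction, it can collect the results of the earlier merges. *)
Lemma dia_right_mset (P : seq sequent) (G D E : {mset formula}) :
  derivable P (G ⇒ E `+` (D `+` D)) -> derivable P (G ⇒ E `+` mset_map Dia D).
Proof.
rewrite /mset_map -{1 2}(seq_mset_id D).
elim: (enum_mset D) E => [|A s IHs] E /=; first by rewrite seq_mset_nil msetD0.
rewrite !mset_cons msetDACA => dE; rewrite msetDA; apply: IHs.
rewrite msetDAC; apply: dia_right.
by rewrite -msetDA -msetDA [X in E `+` X]msetDC.
Qed.

Lemma boxdot_left_mset (P : seq sequent) (G D E : {mset formula}) :
  derivable P (G `+` G `+` E ⇒ D) -> derivable P (mset_map Boxdot G `+` E ⇒ D).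
Proof.
rewrite /mset_map -{1 2}(seq_mset_id G).
elim: (enum_mset G) E => [|A s IHs] E /=; first by rewrite seq_mset_nil !mset0D.
rewrite !mset_cons msetDACA => dE; rewrite -msetDA msetDCA; apply: IHs.
rewrite msetDCA; apply: boxdot_left.
by rewrite !msetDA in dE *.
Qed.

Theorem mainTheorem3 (A : formula) (G D : {mset formula}) :
  derivable [:: (G ⇒ [mset A])] (mset_map Boxdot G ⇒ [mset Boxdot A]) /\
  derivable [:: ([mset A] ⇒ D)] ([mset Dia A] ⇒ mset_map Dia D).
Proof.
split.
- rewrite -[mset_map _ _]msetD0; apply: boxdot_left_mset.
  rewrite msetD0 -(mset0D [mset Boxdot A]) -{1}(mset0D mset0).
  by apply: boxdot_right; apply: Premiss; rewrite mset0D mem_seq1.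
- rewrite -[mset_map _ _]mset0D; apply: dia_right_mset.
  rewrite mset0D -(msetD0 [mset Dia A]) -(msetD0 (_ `+` mset0)).
  by apply: dia_left; apply: Premiss; rewrite msetD0 mem_seq1.
Qed.
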